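(* Let $k\geq 2$. The generating function of the maximal cube polynomials $H_{M_{n,k}}(x)$ of the Munarini graphs is $$\sum_{n\geq 0} H_{M_{n,k}}(x)\,t^n=\frac{1}{1-(k-1)xt-xt^2}$$ as formal power series in $t$ with coefficients in $\mathbb{Z}[x]$.
   Context: For integers $k\geq 1$, $n\geq 0$, a $k$-generalized Pell string of length $n$ is a word of length $n$ over the alphabet $\{0,1,\ldots,k\}$ in which every maximal run of the character $k$ has even length (equivalently, a concatenation of letters from $\{0,1,\ldots,k-1,kk\}$). Let $\mathcal{F}_{n,k}$ be the set of these strings (for $n=0$ it contains only the empty string). The Munarini graph $M_{n,k}$ is the simple graph with vertex set $\mathcal{F}_{n,k}$ in which two vertices are adjacent if one of them can be obtained from the other either by replacing one occurrence of $0$ with some $i\in\{1,\ldots,k-1\}$, or by replacing one substring $00$ (two consecutive positions) with $kk$ (both replacements may be read in either direction, and both strings must be in $\mathcal{F}_{n,k}$). A maximal hypercube of a graph $G$ is an induced subgraph of $G$ isomorphic to a hypercube $Q_p$ for some $p\geq 0$ ($Q_0=K_1$) that is not contained in a larger induced hypercube of $G$. Let $h_p(G)$ be the number of maximal hypercubes of dimension $p$ of $G$; the maximal cube polynomial is $H_G(x)=\sum_{p\geq 0}h_p(G)x^p$. *)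

(* Defs.v *)
From HB Require Import structures.
From mathcomp Require Import all_boot all_order all_algebra.

Set Implicit Arguments.
Unset Strict Implicit.
Unset Printing Implicit Defensive.

Import GRing.Theory.

Section PellStrings.

Variables k n : nat.
Implicit Types s t : n.-tuple 'I_k.+1.

(* The positions i, ..., j - 1 (numbered from 0) carry a nonempty maximal run
   of the letter k, which is ord_max : 'I_k.+1. *)
Definition maximal_run s (i j : nat) : bool :=
  [&& i < j <= n,
      all (fun l => nth ord0 s l == ord_max) (iota i (j - i)),
      (i == 0) || (nth ord0 s i.-1 != ord_max)
    & (j == n) || (nth ord0 s j != ord_max)].

Definition pell_string s : bool :=
  [forall i : 'I_n.+1, forall j : 'I_n.+1,
     maximal_run s i j ==> ~~ odd (j - i)].

Definition replace_0 s t : bool :=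
  [exists i : 'I_n, [&& tnth s i == ord0, 0 < tnth t i < k
    & [forall l : 'I_n, (l != i) ==> (tnth t l == tnth s l)]]].

Definition replace_00 s t : bool :=
  [exists i : 'I_n, exists j : 'I_n,
    [&& j == i.+1 :> nat,
        tnth s i == ord0, tnth s j == ord0,
        tnth t i == ord_max, tnth t j == ord_max
      & [forall l : 'I_n, (l != i) && (l != j) ==> (tnth t l == tnth s l)]]].

Definition munarini_step s t : bool := replace_0 s t || replace_00 s t.

End PellStrings.

Definition munarini_vertex (n k : nat) : finType :=
  {s : n.-tuple 'I_k.+1 | pell_string s}.

Definition munarini_adj (n k : nat) : rel (munarini_vertex n k) :=
  fun u v => munarini_step (val u) (val v) || munarini_step (val v) (val u).

Definition hypercube_adj (p : nat) : rel (p.-tuple bool) :=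
  fun u v => #|[set i : 'I_p | tnth u i != tnth v i]| == 1.

Section MaximalCubes.

Variables (T : finType) (e : rel T).

(* The subgraph of (T, e) induced by S is isomorphic to Q_p. *)
Definition induced_cube (p : nat) (S : {set T}) : bool :=
  [exists f : {ffun p.-tuple bool -> T},
    [&& injectiveb f, [set f u | u : p.-tuple bool] == S
      & [forall u, forall v, e (f u) (f v) == hypercube_adj u v]]].

(* The bound q < #|T| is no restriction: see induced_cube_dim. *)
Definition maximal_cube (p : nat) (S : {set T}) : bool :=
  induced_cube p S &&
  [forall S' : {set T}, forall q : 'I_#|T|,
     induced_cube q S' ==> ~~ (S \proper S')].

Definition nb_maximal_cubes (p : nat) : nat :=
  #|[set S : {set T} | maximal_cube p S]|.

(* The coefficients beyond the bound #|T| vanish: see coef_maximal_cube_poly. *)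
Definition maximal_cube_poly : {poly int} :=
  \poly_(p < #|T|) (nb_maximal_cubes p)%:Z%R.

Lemma induced_cube_dim p S : induced_cube p S -> p < #|T|.
Proof.
case/existsP=> f /and3P[/injectiveP f_inj _ _].
apply: (leq_trans (ltn_expl p (isT : 1 < 2))).
by rewrite -card_bool -card_tuple; apply: leq_card f_inj.
Qed.

Lemma maximal_cubeP p S :
  reflect (induced_cube p S /\
           forall q (S' : {set T}), induced_cube q S' -> ~ (S \proper S'))
          (maximal_cube p S).
Proof.
apply: (iffP andP) => -[cS maxS]; split=> //.
  move=> q S' cS'; apply/negP.
  move/forallP/(_ S')/forallP/(_ (Ordinal (induced_cube_dim cS'))): maxS.
  by move/implyP; apply.
apply/forallP=> S'; apply/forallP=> q; apply/implyP=> cS'.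
by apply/negP; apply: maxS cS'.
Qed.

Lemma coef_maximal_cube_poly p :
  (maximal_cube_poly`_p)%R = (nb_maximal_cubes p)%:Z%R.
Proof.
rewrite coef_poly; case: ltnP => // le_T_p.
rewrite /nb_maximal_cubes (_ : [set S | _] = set0) ?cards0 //.
apply/setP=> S; rewrite !inE; apply/negP=> /andP[/induced_cube_dim].
by rewrite ltnNge le_T_p.
Qed.

End MaximalCubes.

Local Open Scope ring_scope.

(* A formal power series in t over R, given by its coefficient sequence;
   equality of series is pointwise equality. *)
Definition fps (R : Type) := nat -> R.

Section FormalPowerSeries.

Variable R : comUnitRingType.
Implicit Types a b : fps R.

Definition fps_one : fps R := fun n => (n == 0%N)%:R.

Definition fps_mul a b : fps R := fun n => \sum_(i < n.+1) a i * b (n - i)%N.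

Definition fps_of_poly (p : {poly R}) : fps R := fun n => p`_n.

Fixpoint fps_inv_prefix a (n : nat) : seq R :=
  if n is m.+1 then
    let s := fps_inv_prefix a m in
    rcons s ((a 0%N)^-1 * ((m == 0%N)%:R - \sum_(i < m) a i.+1 * s`_(m - i.+1)))
  else [::].

(* The multiplicative inverse in R[[t]] of a series whose constant coefficient
   is a unit: see fps_mulV and fps_inv_unique. *)
Definition fps_inv a : fps R := fun n => (fps_inv_prefix a n.+1)`_n.

Lemma size_fps_inv_prefix a n : size (fps_inv_prefix a n) = n.
Proof. by elim: n => //= n IHn; rewrite size_rcons IHn. Qed.

Lemma nth_fps_inv_prefix a n i :
  (i < n)%N -> (fps_inv_prefix a n)`_i = fps_inv a i.
Proof.
elim: n => // n IHn; rewrite ltnS leq_eqVlt => /predU1P[-> // | lt_i_n].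
by rewrite -(IHn lt_i_n) /= nth_rcons size_fps_inv_prefix lt_i_n.
Qed.

Lemma fps_invE a n :
  fps_inv a n =
  (a 0%N)^-1 * ((n == 0%N)%:R - \sum_(i < n) a i.+1 * fps_inv a (n - i.+1)%N).
Proof.
rewrite {1}/fps_inv /= nth_rcons size_fps_inv_prefix ltnn eqxx.
congr (_ * (_ - _)); apply: eq_bigr => i _.
by rewrite nth_fps_inv_prefix // -subSn // subSS leq_subr.
Qed.

Lemma fps_mulV a : a 0%N \is a GRing.unit -> fps_mul a (fps_inv a) =1 fps_one.
Proof.
move=> Ua n; rewrite /fps_mul big_ord_recl subn0 fps_invE mulVKr //.
by rewrite subrK.
Qed.

Lemma fps_inv_unique a b :
  a 0%N \is a GRing.unit -> fps_mul a b =1 fps_one -> b =1 fps_inv a.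
Proof.
move=> Ua ab1; elim/ltn_ind => n IHn; apply: (mulrI Ua).
have := ab1 n; rewrite -(fps_mulV Ua n) /fps_mul !big_ord_recl !subn0.
rewrite [X in _ + X = _](eq_bigr (fun i : 'I_n =>
  a (lift ord0 i) * fps_inv a (n - lift ord0 i)%N)); first exact: addIr.
move=> i _; rewrite IHn // /lift /= ltn_subrL.
by case: (n) i => // -[].
Qed.

End FormalPowerSeries.

(* Main.v *)
(* A generalized Pell string is a placement of pairwise disjoint blocks (a single
   letter 1, ..., k - 1, or the double letter kk) on n positions, and is encoded
   by its set of blocks.  These sets form a simplicial complex, and two strings
   are adjacent iff their block sets differ in exactly one element.  In such a
   graph every induced hypercube has a vertex containing all its other vertices,
   so the maximal hypercubes are exactly the full power sets of the facets.
   Facets are the strings without the letter 0; splitting off the first block of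
   such a string gives h_n = (k - 1) x h_(n-1) + x h_(n-2). *)
Require Import Defs.
From mathcomp Require Import all_boot all_order all_algebra.
From mathcomp Require Import zify ring.

Set Implicit Arguments.
Unset Strict Implicit.
Unset Printing Implicit Defensive.

(** * Symmetric-difference distance between finite sets *)

Section SetDistance.

Variable I : finType.
Implicit Types A B V W X Y : {set I}.

Definition symdist X Y : nat := #|X :\: Y| + #|Y :\: X|.

Lemma symdistC X Y : symdist X Y = symdist Y X.
Proof. exact: addnC. Qed.

Lemma symdist_eq1P X Y :
  reflect ((Y \subset X /\ #|X| = #|Y|.+1) \/ (X \subset Y /\ #|Y| = #|X|.+1))
          (symdist X Y == 1).
Proof.
have := cardsID X Y; have := cardsID Y X; rewrite setIC /symdist => dX dY.
rewrite -[Y \subset X]setD_eq0 -[X \subset Y]setD_eq0 -!cards_eq0.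
apply: (iffP eqP); last by move=> [] [] /eqP; lia.
case: (posnP #|X :\: Y|) => h0 h1; [right|left]; split; lia.
Qed.

Lemma card_neq_mem X Y : #|[set i | (i \in X) != (i \in Y)]| = symdist X Y.
Proof.
rewrite -(cardsID X) /symdist.
congr (_ + _); apply: eq_card => i; rewrite !inE;
  by case: (i \in X); case: (i \in Y).
Qed.

(** If [V] lay above [A], cardinalities would put it above [B] too; since [A != B], both [V] and [W]
    would then equal [A :|: B]. *)
Lemma lower_corner A B V W :
    A != B -> #|A| = #|B| -> A \subset W -> B \subset W -> #|W| = #|A|.+1 ->
    symdist A V == 1 -> symdist B V == 1 -> V != W ->
  V \subset A /\ #|A| = #|V|.+1.
Proof.
move=> nAB cAB AW BW cW /symdist_eq1P[//|[AV cV]] BV nVW.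
have {}BV : B \subset V.
  by case/symdist_eq1P: BV => -[] // _; rewrite -cAB cV => e; clear -e; lia.
have joinE X : A \subset X -> B \subset X -> #|X| = #|A|.+1 -> X = A :|: B.
  move=> AX BX cX; apply/esym/eqP; rewrite eqEcard subUset AX BX /= cX.
  rewrite ltnNge; apply: contra nAB => cU.
  have /eqP EA : A == A :|: B by rewrite eqEcard subsetUl.
  by rewrite eq_sym eqEcard cAB leqnn andbT EA subsetUr.
by case/eqP: nVW; rewrite (joinE V) // (joinE W).
Qed.

End SetDistance.

Lemma symdist_imset (I J : finType) (f : I -> J) (X Y : {set I}) :
  injective f -> symdist (f @: X) (f @: Y) = symdist X Y.
Proof.
move=> f_inj; have imD (Z U : {set I}) : f @: Z :\: f @: U = f @: (Z :\: U).
  apply/setP=> y; apply/setDP/imsetP => [[/imsetP[x Zx ->]]|[x]].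
    by rewrite mem_imset // => nUx; exists x; rewrite // inE nUx.
  by rewrite inE => /andP[nUx Zx] ->; rewrite !mem_imset.
by rewrite /symdist !imD !card_imset.
Qed.


(** * Coordinate flips and Hamming distance in the hypercube *)

Section HypercubeFlip.

Variable p : nat.
Implicit Types u v : p.-tuple bool.

Definition flip v (i : 'I_p) : p.-tuple bool :=
  [tuple if l == i then ~~ tnth v l else tnth v l | l < p].

Definition hamming u v : nat := #|[set i | tnth u i != tnth v i]|.

Lemma hamming_eq0 u v : (hamming u v == 0) = (u == v).
Proof.
rewrite cards_eq0; apply/eqP/eqP => [/setP duv | ->].
  by apply: eq_from_tnth => i; have := duv i; rewrite !inE => /negbFE/eqP.
by apply/setP=> i; rewrite !inE eqxx.
Qed.

Lemma hypercube_adj_flip v i : hypercube_adj v (flip v i).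
Proof.
apply/eqP; rewrite (_ : [set _ | _] = [set i]) ?cards1 //.
apply/setP=> l; rewrite !inE tnth_mktuple.
by case: (l == i) => //; [case: (tnth v l) | rewrite eqxx].
Qed.

Lemma hamming_flip u v i :
  tnth u i != tnth v i -> hamming u v = (hamming u (flip v i)).+1.
Proof.
move=> uvi; rewrite /hamming (cardsD1 i) inE uvi; congr _.+1.
apply: eq_card => l; rewrite !inE tnth_mktuple.
by case: eqP => [-> | _] //=; move: uvi; case: (tnth u i); case: (tnth v i).
Qed.

End HypercubeFlip.

(** * Maximal cubes in the graph of a simplicial complex *)

Section SimplicialComplex.

Variables (T I : finType) (e : rel T) (D : T -> {set I}).
Hypothesis D_inj : injective D.
Hypothesis D_down : forall v (X : {set I}), X \subset D v -> exists w, D w = X.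
Hypothesis D_adj : forall u v, e u v = (symdist (D u) (D v) == 1).

Definition facet v : bool := [forall w, ~~ (D v \proper D w)].

Definition faces v : {set T} := [set w | D w \subset D v].

Lemma faces_subset v w : (faces v \subset faces w) = (D v \subset D w).
Proof.
apply/subsetP/idP => [/(_ v) | vw x]; first by rewrite !inE; apply.
by rewrite !inE => /subset_trans; apply.
Qed.

Lemma faces_inj : injective faces.
Proof.
move=> v w /eqP; rewrite eqEsubset !faces_subset -eqEsubset => /eqP.
exact: D_inj.
Qed.

(** Membership bits along an enumeration of [D v] serve as cube coordinates; Hamming distance then
    equals symmetric-difference distance. *)
Lemma faces_cube v : induced_cube e #|D v| (faces v).
Proof.
pose U (u : #|D v|.-tuple bool) := [set i | tnth u i].
pose X u : {set I} := [set enum_val i | i in U u].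
have XD u : X u \subset D v.
  by apply/subsetP=> x /imsetP[i _ ->]; apply: enum_valP.
(* The default [v] is never reached: by [D_down] the search always succeeds. *)
pose f := [ffun u => odflt v [pick w | D w == X u]].
have fE u : D (f u) = X u.
  rewrite ffunE; case: pickP => [w /eqP // | none].
  by have [w Dw] := D_down (XD u); have := none w; rewrite Dw eqxx.
apply/existsP; exists f; apply/and3P; split.
- apply/injectiveP => u u' /(congr1 D); rewrite !fE.
  move/(imset_inj enum_val_inj)/setP=> uu'.
  by apply: eq_from_tnth => i; have := uu' i; rewrite !inE.
- rewrite eqEsubset; apply/andP; split; apply/subsetP => w.
    by case/imsetP=> u _ ->; rewrite inE fE.
  rewrite inE => wv; apply/imsetP.
  exists [tuple enum_val i \in D w | i < #|D v|] => //.
  apply: D_inj; rewrite fE; apply/setP=> x; apply/idP/imsetP => [wx|].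
    have vx := subsetP wv x wx; exists (enum_rank_in vx x).
      by rewrite inE tnth_mktuple enum_rankK_in.
    by rewrite enum_rankK_in.
  by case=> i; rewrite inE tnth_mktuple => Dwi ->.
apply/forallP=> u; apply/forallP=> u'; rewrite D_adj !fE.
rewrite symdist_imset; last exact: enum_val_inj.
rewrite -card_neq_mem /hypercube_adj; apply/eqP; congr (_ == 1).
by apply: eq_card => i; rewrite !inE.
Qed.

(* A vertex f u of maximal cardinality dominates the cube: at Hamming distance
   d from u, two neighbours closer to u share a unique upper neighbour, already
   taken by injectivity, so D (f v) must lose one more element. *)
Lemma cube_sub_faces p (S : {set T}) :
  induced_cube e p S -> exists v, S \subset faces v.
Proof.
case/existsP=> f /and3P[/injectiveP f_inj /eqP <- /forallP f_adj].
have adjP u v : hypercube_adj u v -> symdist (D (f u)) (D (f v)) == 1.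
  by move: (forallP (f_adj u) v); rewrite D_adj => /eqP <-.
have Df_neq u v : u != v -> D (f u) != D (f v).
  by apply: contraNneq => /D_inj/f_inj ->.
case: (@arg_maxnP _ [tuple false | i < p] predT (fun u => #|D (f u)|)) => //.
move=> u _ u_max; exists (f u).
suff level d v : hamming u v = d ->
    D (f v) \subset D (f u) /\ #|D (f u)| = #|D (f v)| + d.
  apply/subsetP=> _ /imsetP[v _ ->]; rewrite inE.
  by have [] := level _ v erefl.
elim/ltn_ind: d v => -[|d] IHd v duv.
  by move/eqP: duv; rewrite hamming_eq0 => /eqP <-; rewrite addn0.
case: d => [|d] in IHd duv *.
  have /adjP/symdist_eq1P: hypercube_adj u v by apply/eqP.
  case=> -[sub card]; first by rewrite addn1.
  by have := u_max v isT; rewrite /= card ltnn.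
have: 1 < #|[set i | tnth u i != tnth v i]| by rewrite -/(hamming u v) duv.
case/card_gt1P => i [j] []; rewrite !inE => uvi uvj ij.
have uvij : tnth u j != tnth (flip v i) j.
  by rewrite tnth_mktuple [j == i]eq_sym (negPf ij).
have di : hamming u (flip v i) = d.+1 by apply: succn_inj; rewrite -hamming_flip.
have dj : hamming u (flip v j) = d.+1 by apply: succn_inj; rewrite -hamming_flip.
have dw : hamming u (flip (flip v i) j) = d.
  by apply: succn_inj; rewrite -hamming_flip.
have comm : flip (flip v i) j = flip (flip v j) i.
  apply: eq_from_tnth => l; rewrite !tnth_mktuple.
  by case: (eqVneq l i) => [->|_]; rewrite ?(negPf ij).
have [subi ci] := IHd d.+1 (ltnSn _) _ di.
have [_ cj] := IHd d.+1 (ltnSn _) _ dj.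
have [_ cw] := IHd d (leqnSn _) _ dw.
have cij : #|D (f (flip v i))| = #|D (f (flip v j))|.
  by apply: (@addIn d.+1); rewrite -ci.
have cwi : #|D (f (flip (flip v i) j))| = #|D (f (flip v i))|.+1.
  by apply: (@addIn d); rewrite -cw ci addnS.
have below x y : symdist (D (f x)) (D (f y)) == 1 -> #|D (f y)| = #|D (f x)|.+1 ->
    D (f x) \subset D (f y).
  by case/symdist_eq1P=> -[] // _ ->; move: #|_| => m m2; clear -m2; lia.
have [||||||||vi cvi] := @lower_corner _ (D (f (flip v i))) (D (f (flip v j)))
  (D (f v)) (D (f (flip (flip v i) j))).
- apply: Df_neq; apply/eqP => /(congr1 (fun w => tnth w i)).
  by rewrite !tnth_mktuple eqxx (negPf ij); case: (tnth v i).
- by [].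
- by apply: below; first exact/adjP/hypercube_adj_flip.
- apply: below; first by rewrite comm; exact/adjP/hypercube_adj_flip.
  by rewrite cwi cij.
- by [].
- by rewrite symdistC; exact/adjP/hypercube_adj_flip.
- by rewrite symdistC; exact/adjP/hypercube_adj_flip.
- apply: Df_neq; apply: contra_eq_neq duv => ->.
  by rewrite dw -addn2 -[X in X != _]addn0 eqn_add2l.
split; first exact: subset_trans vi subi.
by rewrite ci cvi addSnnS.
Qed.

(** Every cube lies in some [faces v], itself a cube, so maximality forces equality and makes [v] a
    facet. Conversely, a cube strictly above [faces v] would lie in some [faces w] with [D v]
    properly inside [D w]. *)
Lemma maximal_cube_faces p (S : {set T}) :
  maximal_cube e p S =
  (S \in [set faces v | v in [set v | facet v && (#|D v| == p)]]).
Proof.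
have cube_card q (C : {set T}) : induced_cube e q C -> #|C| = 2 ^ q.
  case/existsP=> f /and3P[/injectiveP f_inj /eqP <- _].
  by rewrite card_imset // card_tuple card_bool.
apply/maximal_cubeP/imsetP => [[cS maxS] | [v]].
  have [v Sv] := cube_sub_faces cS.
  have Sfaces w : S \subset faces w -> S = faces w.
    rewrite subEproper => /predU1P[// | /(maxS _ _ (faces_cube w))[]].
  have SE := Sfaces v Sv; exists v => //; rewrite inE; apply/andP; split.
    apply/forallP=> w; apply/negP=> vw.
    have := Sfaces w; rewrite SE faces_subset (proper_sub vw).
    by move/(_ isT)/faces_inj => vw'; rewrite vw' properxx in vw.
  (* The dimension is read off from the cardinality, a power of 2. *)
  by rewrite -(eqn_exp2l _ _ (isT : 1 < 2)) -(cube_card _ _ (faces_cube v)) -SE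
             (cube_card _ _ cS).
rewrite inE => /andP[/forallP v_max /eqP <-] ->; split; first exact: faces_cube.
move=> q S' /cube_sub_faces[w S'w] vS'.
have vw := proper_sub_trans vS' S'w; have := v_max w.
by rewrite properEneq -faces_subset (proper_sub vw) andbT negbK =>
   /eqP/D_inj vw'; rewrite vw' properxx in vw.
Qed.

Lemma nb_maximal_cubes_facets p :
  nb_maximal_cubes e p = #|[set v | facet v && (#|D v| == p)]|.
Proof.
rewrite -(card_imset _ faces_inj); apply: eq_card => S.
by rewrite inE maximal_cube_faces.
Qed.

End SimplicialComplex.

(** * Parsing strings into blocks *)

Section Blocks.

Variable k : nat.
Hypothesis k_gt0 : 0 < k.
Local Notation letter := 'I_k.+1.

Fact ord0_neq_max : (ord0 : letter) == ord_max = false.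
Proof. by rewrite -val_eqE /= eq_sym eqn0Ngt k_gt0. Qed.

(* Reading s from left to right, position i is the second half of a block kk;
   b is the state in which the reading starts. *)
Fixpoint mid (b : bool) (s : seq letter) (i : nat) : bool :=
  if i is j.+1 then (nth ord0 s j == ord_max) && ~~ mid b s j else b.

(** Positions past the end read as [ord0], so a block [kk] cut off by the end of the string is
    excluded as well. *)
Definition paired b s : Prop := forall i, mid b s i -> nth ord0 s i = ord_max.

Lemma mid_cons b c s i :
  mid b (c :: s) i.+1 = mid ((c == ord_max) && ~~ b) s i.
Proof. by elim: i => //= i ->. Qed.

Lemma paired_mid0 b s i : paired b s -> nth ord0 s i = ord0 -> mid b s i = false.
Proof.
by move=> ps s0; apply/negP=> /ps/eqP; rewrite s0 ord0_neq_max.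
Qed.

(** Along a run of the letter k the state alternates, starting from [false]; [a] is the start of the
    possibly empty run that ends just before [i]. *)
Lemma mid_run s i : exists a, [/\ a <= i, (a == 0) || (nth ord0 s a.-1 != ord_max),
  (forall l, a <= l < i -> nth ord0 s l = ord_max) & mid false s i = odd (i - a)].
Proof.
elim: i => [|i [a [le_ai a_left run IHi]]].
  by exists 0; split=> // l; rewrite ltn0 andbF.
have [smax | smax] := eqVneq (nth ord0 s i) ord_max; last first.
  exists i.+1; split=> //=; last by rewrite subnn (negPf smax).
  by move=> l /andP[il]; rewrite ltnS leqNgt il.
exists a; split=> //; first exact: leqW.
  move=> l /andP[al]; rewrite ltnS leq_eqVlt => /predU1P[-> // | li].
  by apply: run; rewrite al.
by rewrite /= smax eqxx IHi subSn.
Qed.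

Section Strings.

Variable n : nat.
Implicit Types (s t : n.-tuple letter) (X : {set 'I_n * letter}).

(** The state just after a maximal run is the parity of its length, and the letter there is not k;
    so pairing fails exactly after an odd run. *)
Lemma pell_stringP s : reflect (paired false s) (pell_string s).
Proof.
apply: (iffP idP) => [ps i mi | ps].
  apply/eqP/negPn/negP=> si.
  have [a [le_ai a_left run]] := mid_run s i; rewrite mi => /esym odd_ai.
  have lt_ai : a < i.
    rewrite ltn_neqAle le_ai andbT.
    by apply: contraTneq odd_ai => ->; rewrite subnn.
  (* Otherwise the run would contain [i.-1], a position past the end, which reads as [ord0]. *)
  have le_in : i <= n.
    rewrite leqNgt; apply/negP => lt_ni.
    have := run i.-1; rewrite nth_default ?size_tuple; last by lia.
    by move=> H; have /eqP := H ltac:(lia); rewrite ord0_neq_max.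
  have lt_in1 : i < n.+1 by [].
  have lt_an1 : a < n.+1 by lia.
  have a_run : maximal_run s a i.
    apply/and4P; split=> //; first by rewrite lt_ai.
      apply/allP=> l; rewrite mem_iota subnKC // => /run ->; exact: eqxx.
    by rewrite si orbT.
  move/forallP/(_ (Ordinal lt_an1))/forallP/(_ (Ordinal lt_in1)): ps.
  by rewrite /= a_run odd_ai.
apply/forallP=> i; apply/forallP=> j; apply/implyP=> /and4P[/andP[ij jn]].
move=> /allP run i_left j_right.
(* The letter before a maximal run is not k, so the run is entered in state [false]. *)
have midE l : l <= j - i -> mid false s (i + l) = odd l.
  elim: l => [|l IHl] lj.
    by rewrite addn0; case: (nat_of_ord i) i_left => //= i' /negPf ->.
  rewrite addnS /= IHl; last exact: ltnW.
  by rewrite run // mem_iota leq_addr ltn_add2l.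
apply/negP; rewrite -midE // subnKC; last exact: ltnW.
move/ps => sj; case/orP: j_right => [/eqP jE |]; last by rewrite sj eqxx.
move/eqP: sj; rewrite nth_default ?ord0_neq_max //.
by rewrite size_tuple jE.
Qed.

(** A block is encoded by its first position and its letter, so a double letter [kk] is the single
    pair [(i, ord_max)]. *)
Definition items s : {set 'I_n * letter} :=
  [set a : 'I_n * letter |
    [&& nth ord0 s a.1 == a.2, a.2 != ord0 & ~~ mid false s a.1]].

(** Induction from the left: equal states at [i] give equal letters there (k on a second half,
    otherwise the recorded letter or 0), hence equal states at [i.+1]. *)
Lemma items_inj s t :
  paired false s -> paired false t -> items s = items t -> s = t.
Proof.
move=> ps pt /setP st.
have mid_nth i : mid false s i = mid false t i ->
    nth ord0 s i = nth ord0 t i.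
  move=> mi; have [/[dup] ms | ms] := boolP (mid false s i).
    by move/ps=> ->; rewrite pt // -mi.
  have [lt_in | le_ni] := ltnP i n; last by rewrite !nth_default ?size_tuple.
  have := st (Ordinal lt_in, nth ord0 s i).
  have := st (Ordinal lt_in, nth ord0 t i).
  rewrite !inE /= !eqxx -mi ms !andbT.
  have [-> | _] := eqVneq (nth ord0 t i) ord0; last by case: eqP.
  by rewrite andbF eq_sym; case: eqP => //= ->.
have mid_st i : mid false s i = mid false t i.
  by elim: i => //= i IHi; rewrite IHi mid_nth.
by apply: eq_from_tnth => i; rewrite !(tnth_nth ord0) mid_nth.
Qed.

(** Only first positions count: the second half of a block of [X] is not occupied by that block. *)
Definition occupied X (j : nat) : bool :=
  [exists a : 'I_n * letter in X, a.1 == j :> nat].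

(* Erases the blocks of s outside X; i - mid i is the position of the block
   covering i. *)
Definition restrict s X : n.-tuple letter :=
  [tuple if occupied X (i - mid false s i) then nth ord0 s i else ord0 | i < n].

Lemma nth_restrict s X i :
  nth ord0 (restrict s X) i =
  if occupied X (i - mid false s i) then nth ord0 s i else ord0.
Proof.
have [lt_in | le_ni] := ltnP i n; last by rewrite !nth_default ?size_tuple ?if_same.
by rewrite (nth_map (Ordinal lt_in)) ?size_enum_ord // nth_enum_ord.
Qed.

(** An erased k reads as [ord0] and opens no block, so a second half survives exactly when the block
    begun one position earlier is kept. *)
Lemma mid_restrict s X i :
  mid false (restrict s X) i = mid false s i && occupied X i.-1.
Proof.
elim: i => //= i IHi; rewrite nth_restrict IHi.
case: (mid false s i) => /=; last first.
  by rewrite subn0; case: (occupied X i); rewrite ?ord0_neq_max ?andbT ?andbF.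
rewrite subn1; case: (occupied X i.-1); rewrite ?andbF //.
by rewrite ord0_neq_max.
Qed.

Lemma paired_restrict s X : paired false s -> paired false (restrict s X).
Proof.
move=> ps i; rewrite mid_restrict nth_restrict => /andP[mi].
by rewrite mi subn1 => ->; apply: ps.
Qed.

Lemma items_restrict s X : X \subset items s -> items (restrict s X) = X.
Proof.
move/subsetP=> Xs; apply/setP=> -[i c]; rewrite inE /= mid_restrict nth_restrict.
have [ms | ms] /= := boolP (mid false s i).
  transitivity false.
    rewrite subn1; case: (occupied X i.-1); first by rewrite !andbF.
    by rewrite eq_sym; case: eqP.
  by apply/esym/negP => /Xs; rewrite inE /= ms !andbF.
rewrite subn0 andbT; apply/andP/idP => [[sc c0] | Xic]; last first.
  have := Xs _ Xic; rewrite inE /= => /and3P[sc c0 _].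
  suff -> : occupied X i by [].
  by apply/existsP; exists (i, c); rewrite Xic /=.
(* [occupied] supplies some letter [d] at [i]; inclusion of [X] in [items s] identifies it with
   [c]. *)
move: sc; case: ifP => [/existsP[[j d]] | _]; last by rewrite eq_sym (negPf c0).
move=> /andP[Xjd /eqP/val_inj /= ji] /eqP sc; rewrite ji in Xjd.
by have := Xs _ Xjd; rewrite inE /= sc => /andP[/eqP -> _].
Qed.

Lemma restrict_items s t :
  paired false s -> paired false t -> items s \subset items t ->
  s = restrict t (items s).
Proof.
move=> ps pt st; apply: items_inj; rewrite ?items_restrict //.
exact: paired_restrict.
Qed.

(** * Adjacency as insertion of one block *)

Lemma items_insert s t (a : 'I_n * letter) :
  a \notin items s -> items t = a |: items s ->
  items s \subset items t /\ #|items t| = #|items s|.+1.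
Proof. by move=> sa ->; rewrite subsetUr cardsU1 sa. Qed.

(** Neither 0 nor the inserted letter is k, so all states are unchanged and the only new block is
    [(i, nth ord0 t i)]. *)
Lemma replace_0_items s t : paired false s -> replace_0 s t ->
  items s \subset items t /\ #|items t| = #|items s|.+1.
Proof.
move=> ps /existsP[i /and3P[/eqP]]; rewrite !(tnth_nth ord0) => si /andP[ti0 tik].
move=> /forallP ts.
have tsE (l : nat) : l != i -> nth ord0 t l = nth ord0 s l.
  move=> li; have [ln | nl] := ltnP l n; last by rewrite !nth_default ?size_tuple.
  have /implyP := ts (Ordinal ln); rewrite !(tnth_nth ord0) /= => /(_ _)/eqP.
  by apply; rewrite -val_eqE.
have timax : nth ord0 t i != ord_max by rewrite -val_eqE /= neq_ltn tik.
have mE l : mid false t l = mid false s l.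
  elim: l => //= l ->; congr (_ && _).
  have [-> | li] := eqVneq l i; last by rewrite tsE.
  by rewrite si ord0_neq_max (negPf timax).
have mi := paired_mid0 ps si.
apply: (@items_insert _ _ (i, nth ord0 t i)).
  by rewrite inE /= si -val_eqE /= eq_sym -lt0n andbA [_ == 0]eqn0Ngt ti0.
apply/setP=> -[l c]; rewrite !inE /= mE xpair_eqE.
have [-> | li] := eqVneq l i; last by rewrite tsE.
rewrite mi si [ord0 == c]eq_sym /= andbT andbN orbF eq_sym.
by case: eqP => // ->; rewrite -val_eqE /= -lt0n.
Qed.

(** Position [i] carries 0 in [s], hence has state [false]; the inserted pair is therefore read as
    one block, and only the state at [i.+1] changes. *)
Lemma replace_00_items s t : paired false s -> replace_00 s t ->
  items s \subset items t /\ #|items t| = #|items s|.+1.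
Proof.
move=> ps /existsP[i /existsP[j /and5P[/eqP ji]]]; rewrite !(tnth_nth ord0) ji.
move=> /eqP si /eqP sj /eqP ti /andP[/eqP tj /forallP ts].
have tsE (l : nat) : l != i -> l != i.+1 -> nth ord0 t l = nth ord0 s l.
  move=> li lj; have [ln | nl] := ltnP l n; last by rewrite !nth_default ?size_tuple.
  have /implyP := ts (Ordinal ln); rewrite !(tnth_nth ord0) /= => /(_ _)/eqP.
  by apply; rewrite -!val_eqE /= li ji.
have mi := paired_mid0 ps si.
have mE l : mid false t l = (l == i.+1) || mid false s l.
  elim: l => //= l ->; rewrite eqSS.
  have [-> | li] := eqVneq l i; first by rewrite ti eqxx mi (ltn_eqF (ltnSn i)).
  have [-> | lj] := eqVneq l i.+1; first by rewrite sj ord0_neq_max andbF.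
  by rewrite tsE.
apply: (@items_insert _ _ (i, ord_max)).
  by rewrite inE /= si ord0_neq_max.
apply/setP=> -[l c]; rewrite !inE /= mE xpair_eqE.
have [-> | li] := eqVneq l i.
  rewrite (ltn_eqF (ltnSn i)) mi ti si [ord0 == c]eq_sym /= andbT andbN orbF.
  by rewrite eq_sym; case: eqP => // ->; rewrite eq_sym ord0_neq_max.
have [lj | lj] := eqVneq (nat_of_ord l) i.+1; last by rewrite tsE.
by rewrite lj sj /= !andbF [ord0 == c]eq_sym andbA andbN.
Qed.

Lemma munarini_step_items s t : paired false s -> munarini_step s t ->
  items s \subset items t /\ #|items t| = #|items s|.+1.
Proof.
by move=> ps /orP[]; [exact: replace_0_items | exact: replace_00_items].
Qed.

(** Here [s] is [t] with one block [(i, c)] erased: two positions if [c] is k, which is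
    [replace_00], and one otherwise, which is [replace_0]. *)
Lemma items_munarini_step s t : paired false s -> paired false t ->
  items s \subset items t -> #|items t| = #|items s|.+1 -> munarini_step s t.
Proof.
move=> ps pt st card_st.
have /cards1P[[i c] tsE] : #|items t :\: items s| == 1.
  by rewrite cardsD (setIidPr st) card_st subSnn.
have: (i, c) \in items t :\: items s by rewrite tsE set11.
rewrite inE => /andP[s_ic]; rewrite inE /= => /and3P[/eqP ti c0 mi].
have occE (m : nat) : m < n -> nth ord0 t m != ord0 -> ~~ mid false t m ->
    occupied (items s) m = (m != i).
  move=> mn tm0 mm; apply/existsP/idP => [[[j d] /andP[sj /eqP /= jm]] | mi'].
    apply: contraNneq s_ic => im.
    have ji : j = i by apply: val_inj; rewrite /= jm im.
    rewrite ji in sj; suff <- : d = c by [].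
    by have := subsetP st _ sj; rewrite inE /= ti => /andP[/eqP].
  exists (Ordinal mn, nth ord0 t m); rewrite /= eqxx andbT.
  apply: contraT => sm.
  have: (Ordinal mn, nth ord0 t m) \in items t :\: items s.
    by rewrite inE sm inE /= eqxx tm0 mm.
  by rewrite tsE inE xpair_eqE -val_eqE /= (negPf mi').
(* Since [l - mid false t l] is the start of the block covering [l], exactly the letters of the
   block at [i] are erased. *)
have sE l : nth ord0 s l = if l - mid false t l == i then ord0 else nth ord0 t l.
  rewrite {1}(restrict_items ps pt st) nth_restrict.
  have [-> | tl0] := eqVneq (nth ord0 t l) ord0; first by rewrite !if_same.
  have ln : l < n.
    by rewrite ltnNge; apply: contra tl0 => nl; rewrite nth_default ?size_tuple.
  rewrite occE; first by case: eqP.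
  - exact: leq_ltn_trans (leq_subr _ _) ln.
  - case ml: (mid false t l); last by rewrite subn0.
    case: l ml {tl0 ln} => //= l /andP[/eqP tl _].
    by rewrite subn1 /= tl eq_sym ord0_neq_max.
  case ml: (mid false t l); last by rewrite subn0 ml.
  by case: l ml {tl0 ln} => //= l /andP[_]; rewrite subn1.
have si : nth ord0 s i = ord0 by rewrite sE (negPf mi) subn0 eqxx.
have sl_neq (l : nat) : l != i -> l != i.+1 -> nth ord0 s l = nth ord0 t l.
  move=> li lj; rewrite sE; case: eqP => // E.
  by case: (mid false t l) E => E; lia.
have mi1 : mid false t i.+1 = (c == ord_max) by rewrite /= ti mi andbT.
apply/orP; have [cmax | cmax] := eqVneq c ord_max; [right | left].
  rewrite cmax eqxx in mi1; have tj := pt _ mi1.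
  have jn : i.+1 < n.
    rewrite ltnNge; apply/negP => nl; move/eqP: tj.
    by rewrite nth_default ?size_tuple // ord0_neq_max.
  apply/existsP; exists i; apply/existsP; exists (Ordinal jn).
  rewrite !(tnth_nth ord0) /= si ti tj cmax !eqxx sE mi1 subn1 !eqxx /=.
  apply/forallP=> l; apply/implyP=> /andP[li lj].
  by rewrite !(tnth_nth ord0) sl_neq.
apply/existsP; exists i; rewrite !(tnth_nth ord0) si ti eqxx /=.
rewrite lt0n c0 ltn_neqAle -ltnS ltn_ord andbT.
rewrite [_ != _]cmax /=.
apply/forallP=> l; apply/implyP=> li; rewrite !(tnth_nth ord0).
have [lj | lj] := eqVneq (nat_of_ord l) i.+1; last by rewrite sl_neq.
by rewrite lj sE mi1 (negPf cmax) subn0 (gtn_eqF (ltnSn i)).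
Qed.

Lemma munarini_step_symdist s t : paired false s -> paired false t ->
  munarini_step s t || munarini_step t s = (symdist (items s) (items t) == 1).
Proof.
move=> ps pt; apply/orP/symdist_eq1P.
  by case=> /munarini_step_items-/(_ _)[] // sub card; [right | left].
by case=> -[sub card]; [right | left]; apply: items_munarini_step.
Qed.

(** A 0 can be turned into the block 1, enlarging the block set. If [s] has no 0 and arises from [t]
    by erasing blocks, nothing was erased, so [s = t]. *)
Lemma facet_no_zero s : 1 < k -> paired false s ->
  (forall t, paired false t -> ~~ (items s \proper items t)) <-> ord0 \notin s.
Proof.
move=> k_gt1 ps; split=> [smax | s0 t pt].
  apply/negP=> /tnthP[i /esym si].
  (* The letter 1 differs from k because [1 < k]; for k = 1 an isolated 0 could not be filled. *)
  pose t := [tuple if l == i then inord 1 else tnth s l | l < n].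
  have st : replace_0 s t.
    apply/existsP; exists i; rewrite si eqxx tnth_mktuple eqxx inordK ?k_gt1 //=.
    by apply/forallP=> l; apply/implyP=> /negPf li; rewrite tnth_mktuple li.
  have tE l : (nth ord0 t l == ord_max) = (nth ord0 s l == ord_max).
    have [ln | nl] := ltnP l n; last by rewrite !nth_default ?size_tuple.
    rewrite -!(tnth_nth ord0 _ (Ordinal ln)) tnth_mktuple.
    case: (eqVneq (Ordinal ln) i) => [-> | //].
    rewrite si ord0_neq_max -val_eqE /= inordK ?ltn_eqF //; exact: ltnW.
  have mE l : mid false t l = mid false s l by elim: l => //= l ->; rewrite tE.
  have pt : paired false t by move=> l; rewrite mE => /ps/eqP; rewrite -tE => /eqP.
  have [sub card] := replace_0_items ps st.
  by have := smax t pt; rewrite properEcard sub card ltnSn.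
apply/negP=> st; suff E : s = t by rewrite E properxx in st.
have sE := restrict_items ps pt (proper_sub st).
apply: eq_from_tnth => i; have : tnth s i != ord0.
  by apply: contraNneq s0 => <-; apply: mem_tnth.
rewrite !(tnth_nth ord0); have := nth_restrict t (items s) i; rewrite -sE => ->.
by case: ifP; rewrite ?eqxx.
Qed.

End Strings.
End Blocks.

(** * Counting zero-free strings by number of blocks *)

Section CountingFacets.

Variable k : nat.
Hypothesis k_gt0 : 0 < k.
Local Notation letter := 'I_k.+1.

(** A left-to-right automaton for paired zero-free strings, suited to recursion on the first letter;
    [b] records a half-read [kk], which must not remain at the end. *)
Fixpoint full_string (b : bool) (s : seq letter) : bool :=
  if s is c :: s' then
    [&& c != ord0, b ==> (c == ord_max) & full_string ((c == ord_max) && ~~ b) s']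
  else ~~ b.

Fixpoint nb_blocks (b : bool) (s : seq letter) : nat :=
  if s is c :: s' then ~~ b + nb_blocks ((c == ord_max) && ~~ b) s' else 0.

Lemma full_stringP b (s : seq letter) :
  reflect (paired b s /\ ord0 \notin s) (full_string b s).
Proof.
elim: s b => [|c s IHs] b /=.
  apply: (iffP idP) => [/negPf -> | [p0 _]]; first split=> //.
    by move=> i; rewrite nth_nil; elim: i => //= i _; rewrite nth_nil ord0_neq_max.
  (* In state [true] the missing letter at position 0 reads as [ord0], so pairing fails. *)
  by apply/negP=> /(p0 0) /= /eqP; rewrite ord0_neq_max.
apply: (iffP and3P) => [[c0 bc /IHs[ps s0]] | [ps]].
  split; last by rewrite inE eq_sym (negPf c0).
  case=> [|i]; first by move=> /= b1; apply/eqP; rewrite b1 in bc.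
  by rewrite mid_cons; apply: ps.
rewrite inE eq_sym negb_or => /andP[c0 s0]; split=> //.
  by apply/implyP=> b1; apply/eqP; apply: (ps 0).
by apply/IHs; split=> // i; rewrite -mid_cons => /ps.
Qed.

Lemma nb_blocksE b (s : seq letter) :
  nb_blocks b s = \sum_(i < size s) ~~ mid b s i.
Proof.
elim: s b => [|c s IHs] b; first by rewrite big_ord0.
rewrite big_ord_recl [LHS]/= IHs; congr (_ + _); apply: eq_bigr => i _.
by rewrite lift0 mid_cons.
Qed.

(** Without zeros, a block starts at every position in state [false]. *)
Lemma card_items n (s : n.-tuple letter) :
  ord0 \notin s -> #|items s| = nb_blocks false s.
Proof.
move=> s0; rewrite nb_blocksE size_tuple -sum1_card.
rewrite (eq_bigr (fun i : 'I_n => if ~~ mid false s i then 1 else 0)); last first.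
  by move=> i _; case: (mid _ _ _).
rewrite -big_mkcond sum1_card sum1_card.
rewrite -[RHS](card_imset _ (f := fun i : 'I_n => (i, tnth s i))); last by move=> i j [].
apply: eq_card => -[i c]; rewrite inE /=; apply/and3P/imsetP.
  case=> /eqP si c0 mi; exists i => //; congr (_, _).
  by rewrite (tnth_nth ord0).
case=> j mj [-> ->]; rewrite -tnth_nth eqxx; split=> //.
by apply: contraNneq s0 => <-; apply: mem_tnth.
Qed.

Import GRing.Theory.
Local Open Scope ring_scope.

(** For [b = true] the strings complete a [kk] whose first half is already read and counted. *)
Definition full_poly (b : bool) (n : nat) : {poly int} :=
  \sum_(s : n.-tuple letter | full_string b s) 'X^(nb_blocks b s).

Lemma full_poly0 b : full_poly b 0 = (~~ b)%:R.
Proof.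
rewrite /full_poly; case: b.
  by rewrite big_pred0 // => s; rewrite tuple0.
by rewrite (big_pred1 [tuple]) // => s; rewrite tuple0 /= eqxx.
Qed.

Lemma full_polyS b n :
  full_poly b n.+1 =
  \sum_(c : letter | (c != ord0) && (b ==> (c == ord_max)))
    'X^(~~ b) * full_poly ((c == ord_max) && ~~ b) n.
Proof.
rewrite /full_poly.
rewrite (reindex (fun q : letter * n.-tuple letter => [tuple of q.1 :: q.2])) /=.
  under [RHS]eq_bigr do rewrite big_distrr /=.
  rewrite pair_big_dep; apply: eq_big => [[c s] | [c s] _] /=.
    by rewrite andbA.
  by rewrite exprD.
exists (fun s => (thead s, behead_tuple s)) => [[c s] _ | s _] /=.
  by congr (_, _); apply: val_inj.
by rewrite -tuple_eta.
Qed.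

Lemma full_polyTS n : full_poly true n.+1 = full_poly false n.
Proof.
rewrite full_polyS (big_pred1 ord_max) => [|c /=]; first by rewrite eqxx mul1r.
by have [-> | _] := eqVneq c ord_max; rewrite ?andbF // eq_sym ord0_neq_max.
Qed.

(** A first letter k opens a double block; each of the other k - 1 nonzero letters is a block by
    itself. With [full_polyTS] this is the two-term recurrence. *)
Lemma full_polyFS n :
  full_poly false n.+1 =
  (k - 1)%:R * 'X * full_poly false n + 'X * full_poly true n.
Proof.
rewrite full_polyS (bigD1 ord_max) /=; last by rewrite eq_sym ord0_neq_max.
rewrite eqxx /= addrC; congr (_ + _).
rewrite (eq_bigr (fun=> 'X * full_poly false n)); last first.
  by move=> c /andP[_ /negPf ->].
rewrite sumr_const -mulrA mulr_natl; congr (_ *+ _).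
rewrite (eq_card (B := predC (pred2 ord0 ord_max))); last first.
  by move=> c; rewrite [LHS]unfold_in /= andbT !inE negb_or.
(* The k + 1 letters without 0 and k leave k - 1. *)
have := cardC (pred2 (ord0 : letter) ord_max).
rewrite card2 ord0_neq_max // card_ord => /(congr1 (subn^~ 2)).
by rewrite addKn subSS.
Qed.

Hypothesis k_gt1 : (1 < k)%N.

(** The block sets [items] satisfy the hypotheses on [D]; facets are the zero-free strings, and the
    dimension of the cube is the number of blocks. *)
Lemma munarini_maximal_cube_poly n :
  maximal_cube_poly (@munarini_adj n k) = full_poly false n.
Proof.
pose vertex (s : n.-tuple letter) (ps : pell_string s) : munarini_vertex n k :=
  exist (fun t : n.-tuple letter => pell_string t : Prop) s ps.
pose D (v : munarini_vertex n k) := items (val v).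
have vP (v : munarini_vertex n k) : paired false (val v).
  by apply/pell_stringP; [| exact: valP].
have D_inj : injective D.
  by move=> u v Duv; apply/val_inj/items_inj.
have D_down v (X : {set 'I_n * letter}) : X \subset D v -> exists w, D w = X.
  move=> XD.
  have pX : pell_string (restrict (val v) X).
    by apply/pell_stringP/paired_restrict.
  by exists (vertex _ pX); apply: items_restrict.
have D_adj u v : munarini_adj u v = (symdist (D u) (D v) == 1)%N.
  exact: munarini_step_symdist.
have facetE v : facet D v = (ord0 \notin val v).
  apply/forallP/idP => [v_max | v0 w].
    apply/(facet_no_zero k_gt0 k_gt1 (vP v)) => t /(pell_stringP k_gt0) pt.
    exact: (v_max (vertex t pt)).
  by apply: (iffRL (facet_no_zero k_gt0 k_gt1 (vP v))).
apply/polyP=> p; rewrite coef_maximal_cube_poly.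
rewrite (nb_maximal_cubes_facets D_inj D_down D_adj) /full_poly coef_sum.
rewrite (eq_bigr (fun s : n.-tuple letter =>
  if p == nb_blocks false s then 1 else 0)); last first.
  by move=> s _; rewrite coefXn; case: eqP.
rewrite -big_mkcondr sumr_const -(card_imset _ val_inj) natz.
congr (Posz _); apply: eq_card => s; rewrite [RHS]unfold_in /=; apply/imsetP/andP.
  case=> v; rewrite inE facetE => /andP[v0 /eqP <-] ->.
  split; first by apply/full_stringP; split; [exact: vP | exact: v0].
  by rewrite -card_items.
case=> /full_stringP[ps s0] /eqP ->.
have ps' : pell_string s by apply/pell_stringP.
by exists (vertex s ps') => //; rewrite inE facetE /= s0 card_items /=.
Qed.

End CountingFacets.

(** * From the recurrence to the inverse power series *)

Import GRing.Theory.
Local Open Scope ring_scope.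

(* In the denominator, 'X : {poly {poly int}} is t and 'X%:P is x. *)
Theorem theorem4p11 (k : nat) (hk : (2 <= k)%N) :
  (fun n => maximal_cube_poly (@munarini_adj n k)) =1
  fps_inv (fps_of_poly
    (1 - ((k - 1)%:R * ('X : {poly int}))%:P * 'X - ('X : {poly int})%:P * 'X^2)).
Proof.
have k_gt0 : (0 < k)%N by apply: ltnW.
set q := (X in fps_of_poly X).
have qE i : fps_of_poly q i =
    (i == 0%N)%:R - (k - 1)%:R * 'X * (i == 1%N)%:R - 'X * (i == 2%N)%:R.
  by rewrite /fps_of_poly /q !coefB !coefCM coef1 coefX coefXn.
(* The constant coefficient is 1, so it suffices that the product with the denominator is 1. *)
apply: fps_inv_unique => [|n]; first by rewrite qE !mulr0 !subr0 unitr1.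
rewrite /fps_mul /fps_one.
under eq_bigr do rewrite munarini_maximal_cube_poly // qE.
(* Coefficients 0 and 1 are the initial values, with [full_poly true 0 = 0]; from 2 on the
   coefficient vanishes by the recurrence. *)
case: n => [|[|n]].
- by rewrite big_ord1 /= full_poly0 !mulr0 !subr0 mul1r.
- rewrite !big_ord_recl big_ord0 /= full_polyFS // !full_poly0 /=.
  ring.
rewrite !big_ord_recl big1 => [|i _]; last first.
  by rewrite /= !mulr0 !subr0 mul0r.
rewrite /= subn0 !subSS !subn0 full_polyFS // full_polyTS //.
ring.
Qed.
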